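(* Let $r\in\mathbb{N}$, $\mathbf a=(a_1,\ldots,a_r)\in\mathbb{Z}^r$, and let $m_1,\ldots,m_r\in\mathbb{N}$ be pairwise relatively prime with $m=\operatorname{lcm}(m_1,\ldots,m_r)$. Then $$\sum_{\substack{k=1\\ \gcd(k,m)=1}}^m c_{m_1}(k-a_1)\cdots c_{m_r}(k-a_r)=\mu(m)c_{m_1}(a_1)\cdots c_{m_r}(a_r).$$
   Context: For $n\in\mathbb{N}$ and $k\in\mathbb{Z}$, $c_n(k)=\sum_{1\le j\le n,\ \gcd(j,n)=1}\exp(2\pi i jk/n)$ is the Ramanujan sum. $\mu$ is the Möbius function. *)

(* Defs.v *)
From mathcomp Require Import all_boot all_order all_algebra.
From mathcomp Require Import complex.
From mathcomp Require Import reals sequences exp trigo.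

Set Implicit Arguments.
Unset Strict Implicit.
Unset Printing Implicit Defensive.

Import Order.TTheory GRing.Theory Num.Theory.

Local Open Scope ring_scope.
Local Open Scope complex_scope.

(* exp (x + i y) = e^x (cos y + i sin y) *)
Definition cexp (R : realType) (z : R[i]) : R[i] :=
  (expR (complex.Re z))%:C * (cos (complex.Im z) +i* sin (complex.Im z)).

Definition ramanujan_sum (R : realType) (n : nat) (k : int) : R[i] :=
  \sum_(1 <= j < n.+1 | coprime j n)
     cexp (2 * (pi : R)%:C * 'i%C * j%:R * k%:~R / n%:R).

Definition squarefree (n : nat) : bool :=
  (0 < n)%N && all (fun p => ~~ (p ^ 2 %| n)%N) (primes n).

Definition mobius (n : nat) : int :=
  if squarefree n then (-1) ^+ size (primes n) else 0.

(* Main.v *)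
(** By the Chinese remainder theorem the sum factors as the product over [i] of
    the sums of [c_{m_i}(k - a_i)] over the residues [k] prime to [m_i].
    Exchanging summations, each factor is the sum over [j] prime to [m_i] of
    [e(-j a_i / m_i)] times a sum of all primitive [m_i]-th roots of unity; the
    latter is [mu(m_i)], and [c_{m_i}] is even. The value of the sum of the
    primitive [n]-th roots of unity is found by removing one prime factor of
    [n] at a time. *)

Require Import Defs.
From mathcomp Require Import all_boot all_order all_algebra.
From mathcomp Require Import complex.
From mathcomp Require Import reals sequences exp trigo.
From mathcomp Require Import ring lra.

Import Order.TTheory GRing.Theory Num.Theory.

Local Open Scope ring_scope.
Local Open Scope complex_scope.

(** * Sums over residues: periodicity and multiples *)

Lemma sum_coprime_shift (V : nmodType) (d n s : nat) (G : nat -> V) :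
  (d %| n)%N -> (forall k, G (k + n)%N = G k) ->
  \sum_(s <= k < s + n | coprime k d) G k =
  \sum_(0 <= k < n | coprime k d) G k.
Proof.
move=> dn Gn; rewrite big_mkcond [RHS]big_mkcond /=.
(* Extended by 0 off the indices prime to [d], the summand still has period [n] because [d] divides
   [n]. Moving the window by one then trades [H s] for the equal [H (s + n)]. *)
pose H k := if coprime k d then G k else 0.
have Hn k : H (k + n)%N = H k.
  by rewrite /H Gn -coprime_modl -modnDmr (eqP dn) addn0 coprime_modl.
rewrite -/(\sum_(s <= k < s + n) H k) -/(\sum_(0 <= k < n) H k).
elim: s => [//|s <-].
case: n Hn {dn Gn} => [|n] Hn; first by rewrite !addn0 !big_geq.
rewrite addSn big_nat_recr /=; last by rewrite addnS ltnS leq_addr.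
by rewrite Hn addrC [RHS]big_ltn // addnS ltnS leq_addr.
Qed.

Lemma sum_dvdn (V : nmodType) (p n : nat) (G : nat -> V) : (0 < p)%N ->
  \sum_(0 <= j < p * n | (p %| j)%N) G j = \sum_(0 <= i < n) G (p * i)%N.
Proof.
move=> p0; elim: n => [|n IHn]; first by rewrite muln0 !big_geq.
rewrite (@big_cat_nat _ _ _ (p * n)) ?leq_pmul2l //= IHn big_nat_recr //=.
(* Among the indices from [p * n] up to [p * n.+1], excluding the latter, only the first is a
   multiple of [p]. *)
congr (_ + _); rewrite big_ltn_cond ?ltn_pmul2l // dvdn_mulr // big_nat_cond.
rewrite big1 ?addr0 // => j /andP[/andP[ltj jlt] /dvdnP[q jE]]; move: ltj jlt.
by rewrite jE [(q * p)%N]mulnC !ltn_pmul2l // ltnS => /leq_trans h /h; rewrite ltnn.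
Qed.

(** * The Möbius function and sums of primitive roots of unity *)

Lemma squarefreeM (m n : nat) : coprime m n ->
  squarefree (m * n) = squarefree m && squarefree n.
Proof.
move=> co; rewrite /squarefree muln_gt0.
case: (posnP m) => //= m0; case: (posnP n) => /= [_|n0]; first by rewrite andbF.
rewrite (@eq_all_r _ (primes (m * n)%N) (primes m ++ primes n)); last first.
  by move=> p; rewrite mem_cat primesM.
(* A prime factor of [a] is prime to [b], so whether its square divides [a * b] is decided by [a]
   alone. *)
have sqf (a b p : nat) : coprime a b -> p \in primes a ->
    (p ^ 2 %| a * b)%N = (p ^ 2 %| a)%N.
  move=> coab; rewrite mem_primes => /and3P[_ _ /(coprime_dvdl)/(_ coab) copb].
  by rewrite Gauss_dvdl // coprimeXl.
rewrite all_cat; congr (_ && _); apply: eq_in_all => p pin; congr (~~ _).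
  exact: sqf.
by rewrite mulnC; apply: sqf; rewrite // coprime_sym.
Qed.

Lemma mobiusM (m n : nat) : coprime m n ->
  mobius (m * n) = mobius m * mobius n.
Proof.
move=> co; rewrite /mobius squarefreeM //.
case sm: (squarefree m) => /=; last by rewrite mul0r.
case sn: (squarefree n) => /=; last by rewrite mulr0.
have [m0 n0] : (0 < m)%N /\ (0 < n)%N.
  by move: sm sn => /andP[? _] /andP[? _].
rewrite -exprD -size_cat; congr (_ ^+ _); apply: perm_size.
apply: uniq_perm; first exact: primes_uniq.
  by rewrite cat_uniq !primes_uniq andbT -coprime_has_primes.
by move=> p; rewrite mem_cat primesM.
Qed.

Lemma mobius_prime (p : nat) : prime p -> mobius p = -1.
Proof.
move=> pp; rewrite /mobius /squarefree primes_prime //= prime_gt0 //= andbT.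
rewrite ifT ?expr1 //; apply/negP => /(dvdn_leq (prime_gt0 pp)).
by rewrite -{2}[p]expn1 leq_exp2l // prime_gt1.
Qed.

Lemma mobius_sq (p n : nat) : prime p -> (p ^ 2 %| n)%N -> mobius n = 0.
Proof.
move=> pp; rewrite /mobius /squarefree; case: posnP => //= n0 pn.
have pin : p \in primes n.
  by rewrite mem_primes pp n0; apply: dvdn_trans pn; rewrite dvdn_exp.
by case: allP => // /(_ p pin); rewrite pn.
Qed.

(** Strong induction with [n = p * q]: the sum over the [j] prime to [q] vanishes, and discarding
    the multiples of [p] from it leaves the wanted sum. *)
Lemma sum_prim_root_eq_mobius (F : fieldType) (n : nat) (z : F) :
  n.-primitive_root z ->
  \sum_(0 <= j < n | coprime j n) z ^+ j = (mobius n)%:~R.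
Proof.
elim/ltn_ind: n z => n IHn z zn; have n0 := prim_order_gt0 zn.
case: (leqP n 1) => [n1|n1].
  have -> : n = 1%N by case: n n0 n1 {IHn zn} => [|[|]].
  by rewrite big_mkcond big_nat1 coprimen1.
have [p pp pn] : exists2 p, prime p & (p %| n)%N.
  by exists (pdiv n); rewrite ?pdiv_prime ?pdiv_dvd.
have p0 := prime_gt0 pp; have p1 := prime_gt1 pp.
move: pn n0 n1 zn IHn => /dvdnP[q ->]; rewrite mulnC => n0 n1 zn IHn.
have q0 : (0 < q)%N by move: n0; rewrite muln_gt0 p0.
have qlt : (q < p * q)%N by rewrite ltn_Pmull.
(* The residues prime to [q] are stable under translation by [q], which
   multiplies the sum by [z ^+ q != 1]. *)
have A0 : \sum_(0 <= j < p * q | coprime j q) z ^+ j = 0.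
  have zq : z ^+ q != 1.
    rewrite -(prim_order_dvd zn); apply/negP => /(dvdn_leq q0).
    by rewrite leqNgt qlt.
  pose A := \sum_(0 <= j < p * q | coprime j q) z ^+ j.
  have : A = z ^+ q * A.
    rewrite /A -{1}(@sum_coprime_shift _ q (p * q)%N q) ?dvdn_mull //; last first.
      by move=> k; rewrite exprD (prim_expr_order zn) mulr1.
    rewrite -{1}[q]add0n big_addn addnC addnK big_distrr /=.
    apply: eq_big => k; last by rewrite exprD mulrC.
    by rewrite -coprime_modl modnDr coprime_modl.
  move/eqP; rewrite -subr_eq0 -{1}[A]mul1r -mulrBl mulf_eq0 subr_eq0.
  by rewrite eq_sym (negPf zq) => /eqP.
(* When [p] divides [q], being prime to [q] forces being prime to [p], so the vanishing sum is
   already the wanted one. *)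
have [pq|pq] := boolP (p %| q)%N.
  rewrite (@mobius_sq p) //; last by rewrite dvdn_pmul2l.
  rewrite mulr0z -[RHS]A0; apply: eq_bigl => j; rewrite coprimeMr.
  by case: (boolP (coprime j q)) => [/(coprime_dvdr pq) ->|]; rewrite ?andbF.
have copq : coprime p q by rewrite prime_coprime.
rewrite mobiusM // mobius_prime // mulN1r rmorphN /=.
rewrite -(IHn q qlt (z ^+ p)); last first.
  by have := dvdn_prim_root zn (dvdn_mull p (dvdnn q)); rewrite mulnK.
(* Here the multiples [p * i] contribute to the vanishing sum exactly the sum for the primitive
   [q]-th root [z ^+ p], so the wanted sum is its opposite. *)
apply/eqP; rewrite -addr_eq0 -[X in _ == X]A0 [X in _ == X](bigID (dvdn p)) /= addrC.
apply/eqP; congr (_ + _); last first.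
  under [RHS]eq_bigl do rewrite andbC.
  rewrite big_mkcondr sum_dvdn // big_mkcond.
  by apply: eq_bigr => i _; rewrite coprimeMl copq exprM.
apply: eq_bigl => j; rewrite coprimeMr andbC; congr (_ && _).
by rewrite coprime_sym prime_coprime.
Qed.

(** * Factorization by the Chinese remainder theorem *)

Lemma coprime_prod_ord (r : nat) (d : nat) (ms : 'I_r -> nat) :
  (forall i, coprime d (ms i)) -> coprime d (\prod_(i < r) ms i).
Proof.
move=> co; apply: (big_ind (coprime d)) => // [|x y dx dy].
  by rewrite coprimen1.
by rewrite coprimeMr dx.
Qed.

Lemma biglcm_coprime (r : nat) (ms : 'I_r -> nat) :
  (forall i j, i != j -> coprime (ms i) (ms j)) ->
  \big[lcmn/1%N]_(i < r) ms i = (\prod_(i < r) ms i)%N.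
Proof.
elim: r ms => [|r IHr] ms co; first by rewrite !big_ord0.
rewrite !big_ord_recl IHr => [|i j ij]; last by rewrite co.
rewrite -muln_lcm_gcd (eqP (_ : coprime _ _)) ?muln1 //.
by apply: coprime_prod_ord => i; apply: co.
Qed.

(** Functions on residues are encoded by invariance under [%%]. Reduction modulo [m] and [n] matches
    the residues prime to [m * n] with the pairs of residues prime to [m] and to [n]. *)
Lemma sum_coprimeM (S : comPzRingType) (m n : nat) (f g : nat -> S) :
  (0 < m)%N -> (0 < n)%N -> coprime m n ->
  (forall k, f (k %% m)%N = f k) -> (forall k, g (k %% n)%N = g k) ->
  \sum_(k < m * n | coprime k (m * n)) f k * g k =
  (\sum_(i < m | coprime i m) f i) * (\sum_(j < n | coprime j n) g j).
Proof.
move=> m0 n0 co fm gn; have mn0 : (0 < m * n)%N by rewrite muln_gt0 m0.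
rewrite big_distrlr /= pair_big /=.
pose h (u : 'I_m * 'I_n) : 'I_(m * n) :=
  Ordinal (ltn_pmod (chinese m n u.1 u.2) mn0).
pose h' (k : 'I_(m * n)) : 'I_m * 'I_n :=
  (Ordinal (ltn_pmod k m0), Ordinal (ltn_pmod k n0)).
have hm u : h u = u.1 %[mod m].
  by rewrite /= (modn_dvdm _ (dvdn_mulr _ (dvdnn _))) chinese_modl.
have hn u : h u = u.2 %[mod n].
  by rewrite /= (modn_dvdm _ (dvdn_mull _ (dvdnn _))) chinese_modr.
have hK : cancel h h'.
  move=> [i j]; rewrite /h'; congr (_, _); apply: val_inj.
    by rewrite [LHS]hm modn_small.
  by rewrite [LHS]hn modn_small.
have h'K : cancel h' h.
  by move=> k; apply: val_inj; rewrite /= -chinese_mod // modn_small.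
rewrite (reindex h); last by exists h' => u _; rewrite ?hK ?h'K.
apply: eq_big => [u|u _].
  rewrite coprimeMr -(coprime_modl _ m) -[coprime _ n]coprime_modl hm hn.
  by rewrite !coprime_modl.
by rewrite -fm -[g (h u)]gn hm hn fm gn.
Qed.

Lemma sum_coprime_prod (S : comPzRingType) (r : nat) (ms : 'I_r -> nat)
    (f : 'I_r -> nat -> S) :
  (forall i, 0 < ms i)%N ->
  (forall i j, i != j -> coprime (ms i) (ms j)) ->
  (forall i k, f i (k %% ms i)%N = f i k) ->
  \sum_(k < \prod_(i < r) ms i | coprime k (\prod_(i < r) ms i))
     \prod_(i < r) f i k =
  \prod_(i < r) \sum_(k < ms i | coprime k (ms i)) f i k.
Proof.
elim: r ms f => [|r IHr] ms f ms0 co fms.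
  rewrite [RHS]big_ord0.
  under eq_bigr do rewrite big_ord0.
  by rewrite !big_ord0 big_mkcond big_ord1.
rewrite !big_ord_recl /=; under eq_bigr do rewrite big_ord_recl /=.
rewrite -(IHr (ms \o lift ord0) (f \o lift ord0)) //=; last first.
  by move=> i j ij; rewrite co.
rewrite (sum_coprimeM _ _ _ (f ord0) (fun k => \prod_i f (lift ord0 i) k)) //.
- by rewrite prodn_gt0.
- by apply: coprime_prod_ord => i; apply: co.
(* Each factor has its own modulus as a period, and this divides the product of the remaining
   moduli. *)
move=> k; apply: eq_bigr => i _; rewrite -fms modn_dvdm ?fms //.
by rewrite (bigD1 i) //= dvdn_mulr.
Qed.

(** * Roots of unity on the unit circle *)

Definition cis (R : realType) (x : R) : R[i] := cos x +i* sin x.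

Lemma cisD (R : realType) (x y : R) : cis R (x + y) = cis R x * cis R y.
Proof.
by rewrite /cis cosD sinD [sin x * _ + _]addrC.
Qed.

Lemma cis0 (R : realType) : cis R 0 = 1.
Proof. by rewrite /cis cos0 sin0. Qed.

Lemma cisN (R : realType) (x : R) : cis R (- x) = (cis R x)^-1.
Proof.
have xx : cis R (- x) * cis R x = 1 by rewrite -cisD addNr cis0.
have cx : cis R x != 0.
  by apply/eqP => x0; move: xx; rewrite x0 mulr0 => /esym/eqP; rewrite oner_eq0.
by apply: (mulIf cx); rewrite xx mulVf.
Qed.

Lemma cis_nat (R : realType) (x : R) (k : nat) : cis R (x *+ k) = cis R x ^+ k.
Proof. by elim: k => [|k IHk]; rewrite ?cis0 // mulrS cisD IHk exprS. Qed.

Lemma cis_int (R : realType) (x : R) (k : int) : cis R (x *~ k) = cis R x ^ k.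
Proof. by case: k => k; rewrite ?NegzE ?mulrNz ?cisN -?pmulrn cis_nat. Qed.

Definition zeta (R : realType) (n : nat) : R[i] := cis R (2 * pi / n%:R).

(** The real part is [1 - 2 sin^2 (x / 2)], and the sine is positive since [x / 2] lies strictly
    between 0 and [pi]. *)
Lemma cis_neq1 (R : realType) (x : R) : 0 < x < 2 * pi -> cis R x != 1.
Proof.
move=> /andP[x0 xpi]; have xh : 0 < x / 2 < pi by apply/andP; split; lra.
apply/eqP => /(f_equal (@complex.Re R)) /=.
have -> : x = (x / 2) *+ 2 by rewrite mulr2n; lra.
have := sin_gt0_pi xh; rewrite cos_mulr2n cos2sin2; move: (sin _) => s s0.
by nra.
Qed.

(** The exact order [d] divides [n]; were it smaller, the angle of the [d]-th power would lie
    strictly between 0 and a full turn. *)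
Lemma zeta_prim_root (R : realType) (n : nat) :
  (0 < n)%N -> n.-primitive_root (zeta R n).
Proof.
move=> n0; have nR : 0 < n%:R :> R by rewrite ltr0n.
have zn : zeta R n ^+ n = 1.
  rewrite -cis_nat -[_ *+ n]mulr_natr divfK ?gt_eqF //.
  by rewrite /cis mulr_natl cos2pi mulr2n sinDpi sinpi oppr0.
have [d dn dz] := prim_order_exists n0 zn.
suff dE : d = n by rewrite -{1}dE.
have d0 := prim_order_gt0 dn; apply/eqP; rewrite eqn_leq dvdn_leq //=.
rewrite leqNgt; apply/negP => lt_dn.
have /eqP := prim_expr_order dn; apply/negP; rewrite -cis_nat; apply: cis_neq1.
have := pi_gt0 R => pi0.
pose t : R := d%:R / n%:R.
have -> : 2 * pi / n%:R *+ d = 2 * pi * t.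
  by rewrite -[LHS]mulr_natr /t mulrAC mulrA.
have t0 : 0 < t by rewrite divr_gt0 ?ltr0n.
have t1 : t < 1 by rewrite ltr_pdivrMr // mul1r ltr_nat.
by apply/andP; split; nra.
Qed.

(** * Ramanujan sums *)

Lemma ramanujan_sumE (R : realType) (n : nat) (k : int) :
  ramanujan_sum R n k =
  \sum_(1 <= j < n.+1 | coprime j n) zeta R n ^ (j%:Z * k).
Proof.
apply: eq_bigr => j _; rewrite -cis_int.
set x : R := 2 * pi / n%:R *~ _.
(* The argument of [cexp] is purely imaginary, so its modulus is [expR 0 = 1] and only [cis x]
   remains. *)
have -> : 2 * (pi : R)%:C * 'i%C * j%:R * k%:~R / n%:R = 'i%C * x%:C.
  rewrite /x -[2 * pi / _ *~ _]mulrzr intrM !rmorphM /= fmorphV /= !rmorph_nat !rmorph_int.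
  by ring.
by rewrite /cexp /= !mul0r !mul1r subr0 add0r expR0 mul1r.
Qed.

Lemma zeta_unit (R : realType) (n : nat) :
  (0 < n)%N -> zeta R n \is a GRing.unit.
Proof.
move=> n0; rewrite -(unitrX_pos _ n0).
by rewrite (prim_expr_order (zeta_prim_root R n n0)) unitr1.
Qed.

Lemma zeta_expzDM (R : realType) (n : nat) (k t : int) : (0 < n)%N ->
  zeta R n ^ (k + n%:Z * t) = zeta R n ^ k.
Proof.
move=> n0; rewrite exprzDr ?zeta_unit // -exprz_exp -exprnP.
by rewrite (prim_expr_order (zeta_prim_root R n n0)) exp1rz mulr1.
Qed.

Lemma ramanujan_sum_modn (R : realType) (n k : nat) (a : int) : (0 < n)%N ->
  ramanujan_sum R n ((k %% n)%N%:Z - a) = ramanujan_sum R n (k%:Z - a).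
Proof.
move=> n0; rewrite !ramanujan_sumE; apply: eq_bigr => j _.
rewrite -(zeta_expzDM R n _ (j%:Z * (k %/ n)%N%:Z)) //; congr (_ ^ _).
by rewrite {3}(divn_eq k n) PoszD PoszM; ring.
Qed.

Lemma ramanujan_sumN (R : realType) (n : nat) (a : int) : (0 < n)%N ->
  ramanujan_sum R n (- a) = ramanujan_sum R n a.
Proof.
move=> n0; rewrite !ramanujan_sumE -[n.+1]add1n.
(* With the right-hand range moved to start at 0, its reversal sends [j] to [n - j.+1], which pairs
   with the index [j.+1] on the left. *)
rewrite [RHS]sum_coprime_shift => [||j]; last first.
- by rewrite PoszD mulrDl zeta_expzDM.
- by [].
rewrite [RHS]big_nat_rev big_add1 /= add0n big_mkcond [RHS]big_mkcond /=.
apply: eq_big_nat => j /andP[_ jn].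
have -> : coprime (n - j.+1) n = coprime j.+1 n.
  by rewrite /coprime -{2 3}(subnK jn) gcdnDl gcdnDr gcdnC.
case: ifP => // _; rewrite -subzn // mulrBl mulrN addrC.
by rewrite zeta_expzDM.
Qed.

Lemma sum_ramanujan_sum_shift (R : realType) (n : nat) (a : int) :
  (0 < n)%N ->
  \sum_(0 <= k < n | coprime k n) ramanujan_sum R n (k%:Z - a) =
  (mobius n)%:~R * ramanujan_sum R n a.
Proof.
(* Evenness is applied on the right so that, after the exchange, both sides share the factor
   [zeta R n ^ (j * - a)] for each [j]. *)
move=> n0; rewrite -ramanujan_sumN //.
under eq_bigr do rewrite ramanujan_sumE.
rewrite exchange_big ramanujan_sumE mulr_sumr /=; apply: eq_bigr => j jn.
have zj : n.-primitive_root (zeta R n ^+ j).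
  by rewrite prim_root_exp_coprime ?zeta_prim_root.
rewrite -(sum_prim_root_eq_mobius _ _ _ zj) mulr_suml; apply: eq_bigr => k _.
by rewrite mulrDr exprzDr ?zeta_unit // -exprM exprnP PoszM.
Qed.

Lemma mobius_prod (r : nat) (ms : 'I_r -> nat) :
  (forall i j, i != j -> coprime (ms i) (ms j)) ->
  mobius (\prod_(i < r) ms i)%N = \prod_(i < r) mobius (ms i).
Proof.
elim: r ms => [|r IHr] ms co; first by rewrite !big_ord0.
rewrite !big_ord_recl mobiusM; last first.
  by apply: coprime_prod_ord => i; apply: co.
by rewrite IHr // => i j ij; rewrite co.
Qed.

Theorem corollary9 (R : realType) (r : nat) (hr : (0 < r)%N)
    (a : 'I_r -> int) (ms : 'I_r -> nat)
    (hms : forall i, (0 < ms i)%N)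
    (hcop : forall i j, i != j -> coprime (ms i) (ms j))
    (m : nat) (hm : m = \big[lcmn/1%N]_(i < r) ms i) :
  \sum_(1 <= k < m.+1 | coprime k m)
     \prod_(i < r) ramanujan_sum R (ms i) (k%:Z - a i)
  = (mobius m)%:~R * \prod_(i < r) ramanujan_sum R (ms i) (a i).
Proof.
have {hm} mE : m = (\prod_(i < r) ms i)%N by rewrite hm biglcm_coprime.
pose f i k := ramanujan_sum R (ms i) (k%:Z - a i).
have fms i k : f i (k %% ms i)%N = f i k by rewrite /f ramanujan_sum_modn.
(* The range moves from [1..m] to [0..m-1], the residues used in the factorization; each factor has
   period [ms i], a divisor of [m]. *)
rewrite -[m.+1]add1n [LHS]sum_coprime_shift // => [|k]; last first.
  apply: eq_bigr => i _; rewrite -/(f i _) -fms -modnDmr.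
  by rewrite [m]mE (bigD1 i) //= modnMr addn0 fms.
rewrite big_mkord mE (sum_coprime_prod _ _ _ f) // mobius_prod //.
rewrite rmorph_prod -big_split /=; apply: eq_bigr => i _.
by rewrite -sum_ramanujan_sum_shift // big_mkord.
Qed.
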